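(* Let $n>1$ be an integer and let $p$ be a prime number with $p-1\mid n-1$. Let $k$ be the least common multiple of all integers $d\ge 1$ such that $p^d-1\mid n-1$. Then there is an equational proof that every $n$-ring with $p=0$ is a $p^k$-ring.
   Context: Rings are associative and unital, not necessarily commutative; the zero ring is allowed. For an integer $m>1$, an $m$-ring is a ring in which $x^m=x$ holds for every element $x$. Equational proofs. An algebraic theory $\mathcal{T}$ is given by operation symbols of finite arities and a set of axioms, each an equation between terms. An equational proof of $\sigma=\tau$ in $\mathcal{T}$ (written $\mathcal{T}\vdash\sigma=\tau$) is a deduction by the rules: (1) if $\sigma=\tau$ is an axiom then $\mathcal{T}\vdash\sigma=\tau$; (2) $\mathcal{T}\vdash\sigma=\sigma$; (3) if $\mathcal{T}\vdash\sigma=\tau$ then $\mathcal{T}\vdash\tau=\sigma$; (4) if $\mathcal{T}\vdash\sigma=\tau$ and $\mathcal{T}\vdash\tau=\rho$ then $\mathcal{T}\vdash\sigma=\rho$; (5) if $\rho$ is a term of arity $r$ and $\mathcal{T}\vdash\sigma_i=\tau_i$ for $i=1,\dots,r$, then $\mathcal{T}\vdash\rho(\sigma_1,\dots,\sigma_r)=\rho(\tau_1,\dots,\tau_r)$; (6) if $\sigma,\tau$ are terms of arity $r$ with $\mathcal{T}\vdash\sigma=\tau$, then $\mathcal{T}\vdash\sigma(\rho_1,\dots,\rho_r)=\tau(\rho_1,\dots,\rho_r)$ for all terms $\rho_1,\dots,\rho_r$. The theory of $n$-rings with $p=0$ consists of the ring axioms (operations $+,-,0,\cdot,1$) together with the axioms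 $x^n=x$ and $p\cdot 1=0$. ''There is an equational proof that every $n$-ring with $p=0$ is a $p^k$-ring'' means that this theory proves $x^{p^k}=x$ for a variable $x$. *)

(* Defs.v *)
From mathcomp Require Import all_boot.

Set Implicit Arguments.
Unset Strict Implicit.
Unset Printing Implicit Defensive.

Record signature := Signature { op : Type; arity : op -> nat }.

(* Terms of arity r, i.e., terms in the variables indexed by 'I_r. *)
Inductive term (S : signature) (r : nat) : Type :=
  | Var of 'I_r
  | App (f : op S) of {ffun 'I_(arity f) -> term S r}.

Arguments Var {S r} i.
Arguments App {S r} f a.

(* [subst t s] is the term t(s_0, ..., s_(r-1)). *)
Fixpoint subst (S : signature) (r r' : nat) (t : term S r)
    (s : 'I_r -> term S r') : term S r' :=
  match t with
  | Var i => s i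
  | App f a => App f [ffun i => subst (a i) s]
  end.

Record theory := Theory {
  sig : signature;
  axiom : forall r : nat, term sig r -> term sig r -> Prop
}.

Inductive proves (T : theory) :
    forall r : nat, term (sig T) r -> term (sig T) r -> Prop :=
  | proves_axiom r (s t : term (sig T) r) : axiom s t -> proves s t
  | proves_refl r (s : term (sig T) r) : proves s s
  | proves_sym r (s t : term (sig T) r) : proves s t -> proves t s
  | proves_trans r (s t u : term (sig T) r) :
      proves s t -> proves t u -> proves s u
  | proves_congr r r' (u : term (sig T) r) (s t : 'I_r -> term (sig T) r') :
      (forall i, proves (s i) (t i)) -> proves (subst u s) (subst u t)
  | proves_subst r r' (s t : term (sig T) r) (u : 'I_r -> term (sig T) r') :
      proves s t -> proves (subst s u) (subst t u).

Inductive ring_op := AddOp | OppOp | ZeroOp | MulOp | OneOp.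

Definition ring_arity (f : ring_op) : nat :=
  match f with
  | AddOp | MulOp => 2
  | OppOp => 1
  | ZeroOp | OneOp => 0
  end.

Definition ring_sig := Signature ring_arity.

Section RingTerms.
Variable r : nat.
Implicit Types s t : term ring_sig r.

Definition add s t : term ring_sig r :=
  @App ring_sig r AddOp [ffun i : 'I_2 => tnth [tuple s; t] i].
Definition opp s : term ring_sig r :=
  @App ring_sig r OppOp [ffun i : 'I_1 => tnth [tuple s] i].
Definition zero : term ring_sig r :=
  @App ring_sig r ZeroOp [ffun i : 'I_0 => tnth [tuple] i].
Definition mul s t : term ring_sig r :=
  @App ring_sig r MulOp [ffun i : 'I_2 => tnth [tuple s; t] i].
Definition one : term ring_sig r :=
  @App ring_sig r OneOp [ffun i : 'I_0 => tnth [tuple] i].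

(* s + (s + (... + s)) with m summands, and zero if m = 0. *)
Definition natmul s (m : nat) : term ring_sig r := iterop m add s zero.
(* s * (s * (... * s)) with m factors, and one if m = 0. *)
Definition pow s (m : nat) : term ring_sig r := iterop m mul s one.

End RingTerms.

Arguments zero {r}.
Arguments one {r}.

Definition x0 {r : nat} : term ring_sig r.+1 := Var (@Ordinal r.+1 0 isT).
Definition x1 {r : nat} : term ring_sig r.+2 := Var (@Ordinal r.+2 1 isT).
Definition x2 {r : nat} : term ring_sig r.+3 := Var (@Ordinal r.+3 2 isT).

Inductive ring_axiom :
    forall r : nat, term ring_sig r -> term ring_sig r -> Prop :=
  | ax_addA : @ring_axiom 3 (add x0 (add x1 x2)) (add (add x0 x1) x2)
  | ax_addC : @ring_axiom 2 (add x0 x1) (add x1 x0)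
  | ax_add0 : @ring_axiom 1 (add zero x0) x0
  | ax_addN : @ring_axiom 1 (add (opp x0) x0) zero
  | ax_mulA : @ring_axiom 3 (mul x0 (mul x1 x2)) (mul (mul x0 x1) x2)
  | ax_mul1l : @ring_axiom 1 (mul one x0) x0
  | ax_mul1r : @ring_axiom 1 (mul x0 one) x0
  | ax_mulDl : @ring_axiom 3 (mul (add x0 x1) x2) (add (mul x0 x2) (mul x1 x2))
  | ax_mulDr : @ring_axiom 3 (mul x0 (add x1 x2)) (add (mul x0 x1) (mul x0 x2)).

Inductive nring_axiom (n p : nat) :
    forall r : nat, term ring_sig r -> term ring_sig r -> Prop :=
  | ax_ring r (s t : term ring_sig r) : ring_axiom s t -> nring_axiom n p s t
  | ax_pow : @nring_axiom n p 1 (pow x0 n) x0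
  | ax_char : @nring_axiom n p 0 (natmul one p) zero.

Definition nring_theory (n p : nat) : theory := Theory (nring_axiom n p).

Definition equational_proof_nring_is_mring (n p m : nat) : Prop :=
  @proves (nring_theory n p) 1 (pow x0 m) x0.

(* The bound d < n only makes the range of the lcm finite: see
   [lcm_degrees_bound]. *)
Definition lcm_degrees (n p : nat) : nat :=
  \big[lcmn/1]_(1 <= d < n | p ^ d - 1 %| n - 1) d.

Lemma lcm_degrees_bound (n p d : nat) :
  1 < n -> 1 < p -> p ^ d - 1 %| n - 1 -> d < n.
Proof.
move=> n_gt1 p_gt1 /dvdn_leq; rewrite subn_gt0 => /(_ n_gt1) le_pd.
have := ltn_expl d p_gt1; move: le_pd; rewrite leq_subLR addnBA ?(ltnW n_gt1) //.
by rewrite addKn => le_pn lt_dp; apply: leq_trans lt_dp le_pn.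
Qed.

(* Main.v *)
(* Evaluating polynomials over F_p at a variable x by terms reduces the claim to
   commutative algebra in F_p[X]. The polynomials that provably vanish at x form
   an ideal containing P^n - P for every P, so a generator G of the ideal of all
   these differences divides each of them. Such a G is squarefree, and for an
   irreducible factor f of degree d every element of the field F_p[X]/(f)
   satisfies y^n = y, whence p^d - 1 divides n - 1, d divides k, and f divides
   X^(p^k) - X. Thus G divides X^(p^k) - X, which therefore vanishes at x. *)
From mathcomp Require Import all_boot all_fingroup all_algebra all_solvable all_field.
From mathcomp Require Import ring.
From Corelib Require Import Setoid Morphisms.
Require Import Defs.

Set Implicit Arguments.
Unset Strict Implicit.
Unset Printing Implicit Defensive.

Import GRing.Theory.

(** * Polynomials over a finite field *)

Section FinFieldPoly.

Local Open Scope ring_scope.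

Lemma irreducible_factor (F : finFieldType) (P : {poly F}) :
  (1 < size P)%N -> exists2 f, monic_irreducible_poly f & f %| P.
Proof.
have [m] := ubnP (size P); elim: m P => // m IHm P; rewrite ltnS => le_m gt1.
have P_neq0 : P != 0 by rewrite -size_poly_gt0 ltnW.
have [irrP | /irreducibleP redP] := irreducibleP P.
  have lP : (lead_coef P)^-1 != 0 by rewrite invr_eq0 lead_coef_eq0.
  exists ((lead_coef P)^-1 *: P); last by rewrite dvdpZl.
  split; last by rewrite monicE lead_coefZ mulVf // lead_coef_eq0.
  split=> [|q q1]; first by rewrite size_scale.
  rewrite dvdpZr // => /irrP-/(_ q1) eqP.
  by rewrite (eqp_trans eqP) // eqp_sym eqp_scale.
(* The boolean test ranges over polynomials smaller than [P], so its failure yields a nonconstant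
   divisor to which induction applies. *)
move: redP; rewrite /irreducibleb gt1 /= => /forallPn[q].
rewrite -Pdiv.Idomain.dvdpE negb_imply -ltnNge => /andP[qP q_gt1].
have [|f mi_f fq] := IHm q _ q_gt1; last by exists f => //; apply: dvdp_trans qP.
by apply: leq_ltn_trans (size_npoly q) _; rewrite prednK // ltnW.
Qed.

(** The unit group is cyclic of order [#|K| - 1]; cancelling one factor in [a ^+ n = a] for a
    generator [a] shows that this order divides [n - 1]. *)
Lemma finField_exp_id_dvd (K : finFieldType) (n : nat) :
  (0 < n)%N -> (forall y : K, y ^+ n = y) -> (#|K| - 1 %| n - 1)%N.
Proof.
move=> n_gt0 yn; have /cyclicP[a defU] := field_unit_group_cyclic [set: {unit K}]%G.
rewrite subn1 -card_finField_unit defU -orderE order_dvdn.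
apply/eqP/val_inj; rewrite /= FinRing.val_unitX.
apply: (mulIr (valP a)).
by rewrite -exprSr subn1 prednK // yn mul1r.
Qed.

Section ExponentIdentity.

Variables (F : finFieldType) (n k : nat).
Hypothesis n_gt1 : (1 < n)%N.
Hypothesis deg_dvd :
  forall d, (0 < d)%N -> (#|F| ^ d - 1 %| n - 1)%N -> (d %| k)%N.

(** The hypothesis on [f] says that y^n = y in the field [K] = F[X]/(f), which has #|F|^d elements
    for d the degree of [f]. Hence d divides [k], and iterating y^#|K| = y at the class of X gives
    the claim. *)
Lemma irreducible_dvd_Xq_sub_X (f : {poly F}) :
    monic_irreducible_poly f -> (forall P : {poly F}, f %| P ^+ n - P) ->
  f %| 'X^(#|F| ^ k) - 'X.
Proof.
move=> mi_f fP; pose K := {poly %/ f with mi_f}.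
have in_eq0 (P : {poly F}) : (in_qpoly f P == 0) = (f %| P).
  by rewrite -val_eqE /= mk_monicE // /dvdp Pdiv.IdomainMonic.modpE ?mi_f.2.
have yn (y : K) : y ^+ n = y.
  have -> : y = in_qpoly f (val y).
    by apply/val_inj/esym/in_qpoly_small/size_mk_monic.
  apply/eqP; rewrite -subr_eq0.
  by rewrite -[_ ^+ n]rmorphXn -rmorphB /= in_eq0.
have := finField_exp_id_dvd (ltnW n_gt1) yn.
rewrite card_qfpoly.
have size_gt1 := mi_f.1.1.
move/deg_dvd; rewrite -ltnS prednK ?(ltnW size_gt1) // => /(_ size_gt1)/dvdnP[e ->].
rewrite -in_eq0 rmorphB rmorphXn subr_eq0 /= mulnC expnM -(card_qfpoly mi_f).
apply/eqP; move: (in_qpoly f 'X : K); elim: e => [|e IHe] y; first by rewrite expr1.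
by rewrite expnS exprM [y ^+ _]expf_card IHe.
Qed.

Lemma dvd_Xq_sub_X (G : {poly F}) :
    G != 0 -> (forall P : {poly F}, G %| P ^+ n - P) ->
  G %| 'X^(#|F| ^ k) - 'X.
Proof.
move=> G_neq0 GP; set H := _ - _.
(* Squarefreeness of [G]: if P^2 vanishes modulo [G], so does P^n because n >= 2, and P^n is
   congruent to P. *)
have dvd_of_sqr (P : {poly F}) : G %| P ^+ 2 -> G %| P.
  move=> GP2; have GPn : G %| P ^+ n by rewrite -(subnKC n_gt1) exprD dvdp_mulr.
  by have := dvdp_sub GPn (GP P); rewrite opprB addrC subrK.
pose D := gcdp G H; pose E := G %/ D.
have defG : G = E * D by rewrite divpK // dvdp_gcdl.
have E_neq0 : E != 0 by apply: contraNneq G_neq0; rewrite defG => ->; rewrite mul0r.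
have [E_le1 | /irreducible_factor[f mi_f fE]] := leqP (size E) 1.
  have /size_poly1P[c c_neq0 defE] : size E == 1%N.
    by rewrite eqn_leq E_le1 size_poly_gt0.
  by rewrite defG defE mul_polyC dvdpZl // dvdp_gcdr.
(* If the cofactor [E] had an irreducible factor [f], then [f] would also divide [D], and f^2 would
   divide [G]. Then [G] divides the square of G/f, hence G/f itself, which has smaller degree. *)
have fG : f %| G by rewrite defG dvdp_mulr.
have fH : f %| H by apply: irreducible_dvd_Xq_sub_X => // P; apply: dvdp_trans (GP P).
have fD : f %| D by rewrite dvdp_gcd fG.
have /dvdpP[E' defE] := fE; have /dvdpP[D' defD] := fD.
have defG' : G = E' * D' * f * f by rewrite defG defE defD; ring.
have /dvd_of_sqr : G %| (E' * D' * f) ^+ 2.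
  by apply/dvdpP; exists (E' * D'); rewrite defG'; ring.
move: G_neq0; rewrite defG'; set P := E' * D' * f => Pf_neq0.
have P_neq0 : P != 0 by apply: contraNneq Pf_neq0 => ->; rewrite mul0r.
move/(dvdp_leq P_neq0); rewrite size_Mmonic ?mi_f // leqNgt.
by have [[]] := mi_f; case: (size f) => [|[|m]] // _ _ _; rewrite !addnS /= ltnS leq_addr.
Qed.

End ExponentIdentity.

End FinFieldPoly.

(** * Substitution commutes with the ring operations on terms *)

Section RingTermSubst.

Variables (r r' : nat) (u : 'I_r -> term ring_sig r').

Lemma subst_add s t : subst (add s t) u = add (subst s u) (subst t u).
Proof. by congr App; apply/ffunP=> -[[|[|i]] // lti]; rewrite !ffunE. Qed.

Lemma subst_mul s t : subst (mul s t) u = mul (subst s u) (subst t u).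
Proof. by congr App; apply/ffunP=> -[[|[|i]] // lti]; rewrite !ffunE. Qed.

Lemma subst_opp s : subst (opp s) u = opp (subst s u).
Proof. by congr App; apply/ffunP=> -[[|i] // lti]; rewrite !ffunE. Qed.

Lemma subst_zero : subst zero u = zero.
Proof. by congr App; apply/ffunP=> -[]. Qed.

Lemma subst_one : subst one u = one.
Proof. by congr App; apply/ffunP=> -[]. Qed.

Lemma subst_natmul s m : subst (natmul s m) u = natmul (subst s u) m.
Proof.
elim: m => [|[|m] IHm] //; first exact: subst_zero.
by rewrite -[natmul s _]/(add s (natmul s m.+1)) subst_add IHm.
Qed.

Lemma subst_pow s m : subst (pow s m) u = pow (subst s u) m.
Proof.
elim: m => [|[|m] IHm] //; first exact: subst_one.
by rewrite -[pow s _]/(mul s (pow s m.+1)) subst_mul IHm.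
Qed.

End RingTermSubst.

Definition substE :=
  (subst_add, subst_mul, subst_opp, subst_zero, subst_one, subst_natmul, subst_pow).

(** * Ring calculus modulo provable equality *)

Section NringProofs.

Local Open Scope ring_scope.

Variables (n p r : nat).

Definition nring_eq : relation (term ring_sig r) := @proves (nring_theory n p) r.

Local Infix "~" := nring_eq (at level 70).
Implicit Types a b c d : term ring_sig r.

#[local] Instance nring_eq_equiv : Equivalence nring_eq.
Proof.
split=> [s|s t|s t u]; [exact: proves_refl | exact: proves_sym | exact: proves_trans].
Qed.

Lemma nring_eq_refl a : a ~ a.
Proof. exact: proves_refl. Qed.
#[local] Hint Resolve nring_eq_refl : core.

#[local] Instance add_proper : Proper (nring_eq ==> nring_eq ==> nring_eq)%signature (@add r).
Proof.
move=> s s' eq_s t t' eq_t.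
have := @proves_congr (nring_theory n p) _ _ (add x0 x1)
  (tnth [tuple s; t]) (tnth [tuple s'; t']).
by rewrite !substE; apply=> -[[|[|i]] // lti].
Qed.

#[local] Instance mul_proper : Proper (nring_eq ==> nring_eq ==> nring_eq)%signature (@mul r).
Proof.
move=> s s' eq_s t t' eq_t.
have := @proves_congr (nring_theory n p) _ _ (mul x0 x1)
  (tnth [tuple s; t]) (tnth [tuple s'; t']).
by rewrite !substE; apply=> -[[|[|i]] // lti].
Qed.

Lemma nring_eq_axiom r' (s t : term ring_sig r') (u : r'.-tuple (term ring_sig r)) :
  nring_axiom n p s t -> subst s (tnth u) ~ subst t (tnth u).
Proof. by move=> ax; apply: proves_subst; apply: proves_axiom. Qed.

Lemma addtA a b c : add a (add b c) ~ add (add a b) c.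
Proof. by have := nring_eq_axiom [tuple a; b; c] (ax_ring n p ax_addA); rewrite !substE. Qed.

Lemma addtC a b : add a b ~ add b a.
Proof. by have := nring_eq_axiom [tuple a; b] (ax_ring n p ax_addC); rewrite !substE. Qed.

Lemma add0t a : add zero a ~ a.
Proof. by have := nring_eq_axiom [tuple a] (ax_ring n p ax_add0); rewrite !substE. Qed.

Lemma addNt a : add (opp a) a ~ zero.
Proof. by have := nring_eq_axiom [tuple a] (ax_ring n p ax_addN); rewrite !substE. Qed.

Lemma multA a b c : mul a (mul b c) ~ mul (mul a b) c.
Proof. by have := nring_eq_axiom [tuple a; b; c] (ax_ring n p ax_mulA); rewrite !substE. Qed.

Lemma mul1t a : mul one a ~ a.
Proof. by have := nring_eq_axiom [tuple a] (ax_ring n p ax_mul1l); rewrite !substE. Qed.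

Lemma mult1 a : mul a one ~ a.
Proof. by have := nring_eq_axiom [tuple a] (ax_ring n p ax_mul1r); rewrite !substE. Qed.

Lemma multDl a b c : mul (add a b) c ~ add (mul a c) (mul b c).
Proof. by have := nring_eq_axiom [tuple a; b; c] (ax_ring n p ax_mulDl); rewrite !substE. Qed.

Lemma multDr a b c : mul a (add b c) ~ add (mul a b) (mul a c).
Proof. by have := nring_eq_axiom [tuple a; b; c] (ax_ring n p ax_mulDr); rewrite !substE. Qed.

Lemma powt_n a : pow a n ~ a.
Proof. by have := nring_eq_axiom [tuple a] (ax_pow n p); rewrite !substE. Qed.

Lemma natmul1t_p : natmul one p ~ zero.
Proof. by have := nring_eq_axiom [tuple] (ax_char n p); rewrite !substE. Qed.

Lemma addt0 a : add a zero ~ a.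
Proof. by rewrite addtC add0t. Qed.

Lemma addtI a b c : add a b ~ add a c -> b ~ c.
Proof. by move=> eq_abc; rewrite -(add0t b) -(add0t c) -(addNt a) -!addtA eq_abc. Qed.

Lemma addtACA a b c d : add (add a b) (add c d) ~ add (add a c) (add b d).
Proof. by rewrite -(addtA a b) (addtA b c) (addtC b c) -(addtA c b) addtA. Qed.

Lemma mul0t a : mul zero a ~ zero.
Proof. by apply: (addtI (a := mul zero a)); rewrite -multDl !addt0. Qed.

Lemma mult0 a : mul a zero ~ zero.
Proof. by apply: (addtI (a := mul a zero)); rewrite -multDr !addt0. Qed.

Lemma natmulS a m : natmul a m.+1 ~ add a (natmul a m).
Proof. by case: m => [|m]; [rewrite addt0 | apply: proves_refl]. Qed.

Lemma natmulD a m1 m2 : natmul a (m1 + m2) ~ add (natmul a m1) (natmul a m2).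
Proof.
elim: m1 => [|m1 IHm]; first by rewrite add0t.
by rewrite addSn !natmulS IHm addtA.
Qed.

(** This makes numerals compatible with addition in ['F_p], which reduces representatives modulo
    [p]. *)
Lemma natmul1t_mod m : natmul one (m %% p) ~ natmul one m.
Proof.
rewrite [in X in _ ~ X](divn_eq m p) natmulD.
have -> : natmul one (m %/ p * p) ~ zero; last by rewrite add0t.
by elim: (m %/ p)%N => // e IHe; rewrite mulSn natmulD IHe natmul1t_p add0t.
Qed.

Lemma natmul1tC m a : mul (natmul one m) a ~ mul a (natmul one m).
Proof.
elim: m => [|m IHm]; first by rewrite mul0t mult0.
by rewrite natmulS multDl multDr mul1t mult1 IHm.
Qed.

Lemma powS a m : pow a m.+1 ~ mul a (pow a m).
Proof. by case: m => [|m]; [rewrite mult1 | apply: proves_refl]. Qed.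

#[local] Instance pow_proper : Proper (nring_eq ==> eq ==> nring_eq)%signature (@pow r).
Proof. by move=> a b eq_ab m _ <-; elim: m => // m IHm; rewrite !powS IHm eq_ab. Qed.

(** * Evaluation of polynomials over ['F_p] at a term *)

Section Evaluation.

Hypothesis p_prime : prime p.
Variable x : term ring_sig r.
Implicit Types P Q : {poly 'F_p}.

(** Horner's scheme on the coefficient list, constant coefficient first; each coefficient becomes
    the numeral of its representative below [p]. *)
Definition horner_term P : term ring_sig r :=
  foldr (fun (c : 'F_p) t => add (mul t x) (natmul one c)) zero P.

Lemma horner_term0 : horner_term 0 = zero.
Proof. by rewrite /horner_term polyseq0. Qed.

Lemma horner_termMXaddC P (c : 'F_p) :
  horner_term (P * 'X + c%:P) ~ add (mul (horner_term P) x) (natmul one c).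
Proof.
rewrite -cons_poly_def {1}/horner_term polyseq_cons.
(* Only for zero [P] can the coefficient list differ from [c] followed by that of [P]: it is empty
   when [c] is zero too. *)
have [/nilP | //] := boolP (nilp P); rewrite -polyseq0 => /poly_inj->.
rewrite horner_term0 polyseqC; have [->|_] := eqVneq c 0; last by [].
by rewrite mul0t /= add0t.
Qed.

Lemma horner_termMX P : horner_term (P * 'X) ~ mul (horner_term P) x.
Proof. by rewrite -[P * 'X]addr0 horner_termMXaddC addt0. Qed.

Lemma horner_termC (c : 'F_p) : horner_term c%:P ~ natmul one c.
Proof.
by rewrite -[c%:P]add0r -(mul0r 'X) horner_termMXaddC horner_term0 mul0t add0t.
Qed.

Lemma horner_term1 : horner_term 1 ~ one.
Proof. exact: horner_termC 1. Qed.

Lemma horner_termX : horner_term 'X ~ x.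
Proof. by rewrite -['X]mul1r horner_termMX horner_term1 mul1t. Qed.

Lemma horner_termD P Q : horner_term (P + Q) ~ add (horner_term P) (horner_term Q).
Proof.
elim/poly_ind: P Q => [|P c IHP] Q; first by rewrite add0r horner_term0 add0t.
elim/poly_ind: Q => [|Q d _]; first by rewrite addr0 horner_term0 addt0.
rewrite addrACA -mulrDl -polyCD !horner_termMXaddC IHP multDl.
by rewrite addtACA -natmulD /= [X in (_ %% X)%N]Fp_cast // natmul1t_mod.
Qed.

Lemma horner_termMn P m : horner_term (P *+ m) ~ mul (natmul one m) (horner_term P).
Proof.
elim: m => [|m IHm]; first by rewrite mulr0n horner_term0 mul0t.
by rewrite mulrS horner_termD IHm natmulS multDl mul1t.
Qed.

(** Multiplication of terms is not commutative, but numerals are central, so [x] can be moved past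
    any polynomial in [x]. *)
Lemma horner_term_comm P : mul x (horner_term P) ~ mul (horner_term P) x.
Proof.
elim/poly_ind: P => [|P c IHP]; first by rewrite horner_term0 mul0t mult0.
by rewrite horner_termMXaddC multDr multDl natmul1tC multA IHP.
Qed.

Lemma horner_termM P Q : horner_term (P * Q) ~ mul (horner_term P) (horner_term Q).
Proof.
elim/poly_ind: P Q => [|P c IHP] Q; first by rewrite mul0r horner_term0 mul0t.
(* Writing the scalar multiple as a repeated sum reduces it to additivity of the evaluation. *)
have -> : (P * 'X + c%:P) * Q = P * Q * 'X + Q *+ c.
  by rewrite -mulr_natl -polyC_natr natr_Zp; ring.
rewrite horner_termD horner_termMX horner_termMn IHP.
by rewrite horner_termMXaddC multDl -!multA horner_term_comm.
Qed.

Lemma horner_termXn P m : horner_term (P ^+ m) ~ pow (horner_term P) m.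
Proof.
elim: m => [|m IHm]; first exact: horner_term1.
by rewrite exprS horner_termM IHm powS.
Qed.

Lemma horner_term_exp_sub_id P : horner_term (P ^+ n - P) ~ zero.
Proof.
(* Adding P back and cancelling avoids evaluating an opposite. *)
apply: (addtI (a := horner_term P)).
by rewrite -horner_termD addrC subrK horner_termXn powt_n addt0.
Qed.

Lemma horner_term_gcdp P Q :
  horner_term P ~ zero -> horner_term Q ~ zero -> horner_term (gcdp P Q) ~ zero.
Proof.
move=> P0 Q0; have [[u v] /= /eqpP[[c d] /= /andP[c_neq0 d_neq0] def_gcd]] := Bezoutp P Q.
(* The Bezout combination equals the gcd only up to nonzero scalars. *)
have -> : gcdp P Q = d^-1 *: (c *: (u * P + v * Q)).
  by rewrite def_gcd scalerA mulVf ?scale1r.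
rewrite -!mul_polyC !horner_termM horner_termD !horner_termM P0 Q0.
by rewrite !mult0 add0t mult0 mult0.
Qed.

(* Modulo [X^n - X] there are finitely many polynomials, so the ideal generated
   by all the [P^n - P] is generated by finitely many of them, hence by their
   gcd. *)
Lemma horner_term_annihilator : (1 < n)%N -> exists G : {poly 'F_p},
  [/\ G != 0, horner_term G ~ zero & forall P, G %| P ^+ n - P].
Proof.
move=> n_gt1; pose H : {poly 'F_p} := 'X^n - 'X.
have size_H : size H = n.+1.
  by rewrite size_polyDl size_polyXn // size_polyN size_polyX.
have H_neq0 : H != 0 by rewrite -size_poly_eq0 size_H.
have [G [G0 GH GP]] : exists G : {poly 'F_p}, [/\ horner_term G ~ zero, G %| H &
    {in enum {poly_n 'F_p}, forall R, G %| polyn R ^+ n - polyn R}].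
  elim: (enum _) => [|P s [G [G0 GH GP]]].
    by exists H; split; rewrite ?dvdpp //; apply: horner_term_exp_sub_id.
  exists (gcdp (polyn P ^+ n - polyn P) G); split.
  - exact: horner_term_gcdp (horner_term_exp_sub_id _) G0.
  - exact: dvdp_trans (dvdp_gcdr _ _) GH.
  - move=> Q; rewrite inE => /predU1P[-> | /GP]; first exact: dvdp_gcdl.
    exact: dvdp_trans (dvdp_gcdr _ _).
exists G; split=> [|//|P]; first by apply: contraTneq GH => ->; rewrite dvd0p.
have size_mod : (size (P %% H)%R <= n)%N by rewrite -ltnS -size_H ltn_modp.
have GR : G %| (P %% H) ^+ n - P %% H by apply: (GP (NPoly size_mod)); rewrite mem_enum.
have GPR : G %| P - P %% H by rewrite {1}(divp_eq P H) addrK dvdp_mull.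
(* P and its remainder are congruent modulo [G], hence so are their n-th powers. *)
have -> : P ^+ n - P =
    P ^+ n - (P %% H) ^+ n - (P - P %% H) + ((P %% H) ^+ n - P %% H) by ring.
by rewrite dvdp_add // dvdp_sub // subrXX dvdp_mulr.
Qed.

Lemma powt_of_dvdp G m : horner_term G ~ zero -> G %| 'X^m - 'X -> pow x m ~ x.
Proof.
move=> G0 /dvdpP[Q defQ]; rewrite -{1}horner_termX -horner_termXn.
by rewrite -['X^m](subrK 'X) defQ horner_termD horner_termM G0 mult0 add0t horner_termX.
Qed.

End Evaluation.

End NringProofs.

(** * The least common multiple of the degrees, and the conclusion *)

Lemma dvdn_lcm_degrees n p d : (1 < n)%N -> (1 < p)%N ->
  (0 < d)%N -> (p ^ d - 1 %| n - 1)%N -> (d %| lcm_degrees n p)%N.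
Proof.
move=> n_gt1 p_gt1 d_gt0 d_dvd; have d_lt := lcm_degrees_bound n_gt1 p_gt1 d_dvd.
rewrite /lcm_degrees big_mkcond (bigD1_seq d) ?iota_uniq ?mem_index_iota ?d_gt0 //=.
by rewrite d_dvd dvdn_lcml.
Qed.

Theorem theorem1p2 (n p : nat) (n_gt1 : 1 < n) (p_prime : prime p)
    (p_dvd : p - 1 %| n - 1) :
  equational_proof_nring_is_mring n p (p ^ lcm_degrees n p).
Proof.
have [G [G_neq0 G0 GP]] := horner_term_annihilator p_prime (@x0 0) n_gt1.
have deg_dvd d := @dvdn_lcm_degrees n p d n_gt1 (prime_gt1 p_prime).
have := @dvd_Xq_sub_X 'F_p n (lcm_degrees n p) n_gt1.
rewrite card_Fp // => /(_ deg_dvd G G_neq0 GP).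
exact: powt_of_dvdp.
Qed.
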